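(* Let $p,q>0$ be real numbers with $pq\ge 4$. Then every orbit of the map $\mu=\mu_2\circ\mu_1$ on $\mathbb{R}^+\times\mathbb{R}^+$ is unbounded; that is, for every $(x,y)\in\mathbb{R}^+\times\mathbb{R}^+$ the set $\{\mu^k(x,y): k\ge 0\}$ is an unbounded subset of $\mathbb{R}^2$.
   Context: $\mathbb{R}^+$ denotes the positive real numbers. For positive reals $p,q$, the maps $\mu_1,\mu_2$ on $\mathbb{R}^+\times\mathbb{R}^+$ are $\mu_1(x,y)=\left(\frac{1+y^q}{x},\,y\right)$ and $\mu_2(x,y)=\left(x,\,\frac{1+x^p}{y}\right)$, and $\mu=\mu_2\circ\mu_1$, so $\mu(x,y)=\left(\frac{1+y^q}{x},\ \frac{x^p+(1+y^q)^p}{x^p y}\right)$. *)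

(* Defs.v *)
From mathcomp Require Import all_boot all_order all_algebra.
From mathcomp Require Import all_classical all_reals all_analysis.

Set Implicit Arguments.
Unset Strict Implicit.
Unset Printing Implicit Defensive.

Import Order.TTheory GRing.Theory Num.Theory.
Import numFieldNormedType.Exports.

Local Open Scope classical_set_scope.
Local Open Scope ring_scope.

(* The maps below are total on R * R; they agree with the intended maps on the
   positive quadrant, which they preserve (mu_gt0). Outside of it, the values
   are the conventional ones of powR and of division by zero. *)
Definition mu1 (R : realType) (q : R) (z : R * R) : R * R :=
  ((1 + z.2 `^ q) / z.1, z.2).

Definition mu2 (R : realType) (p : R) (z : R * R) : R * R :=
  (z.1, (1 + z.1 `^ p) / z.2).

Definition mu (R : realType) (p q : R) : R * R -> R * R := mu2 p \o mu1 q.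

Definition mu_orbit (R : realType) (p q : R) (z : R * R) : set (R * R) :=
  [set iter k (mu p q) z | k in [set: nat]].

Lemma mu_gt0 (R : realType) (p q : R) (z : R * R) :
  0 < z.1 -> 0 < z.2 -> 0 < (mu p q z).1 /\ 0 < (mu p q z).2.
Proof.
move=> z1 z2; have h : 0 < (mu p q z).1.
  by rewrite /= divr_gt0// ltr_pwDl// powR_ge0.
by split => //; rewrite /= divr_gt0// ltr_pwDl// powR_ge0.
Qed.

Lemma muE (R : realType) (p q x y : R) : 0 < x -> 0 < y ->
  mu p q (x, y) =
  ((1 + y `^ q) / x, (x `^ p + (1 + y `^ q) `^ p) / (x `^ p * y)).
Proof.
move=> x0 y0; rewrite /mu /mu1 /mu2 /=; congr pair.
have xp : x `^ p != 0 by rewrite gt_eqF// powR_gt0.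
rewrite powRM ?invr_ge0 ?(ltW x0)//; last by rewrite addr_ge0// powR_ge0.
have -> : x^-1 `^ p = (x `^ p)^-1.
  apply: (mulfI xp); rewrite mulfV// -powRM ?invr_ge0 ?(ltW x0)//.
  by rewrite mulfV ?gt_eqF// powR1.
rewrite -[X in (X + _) / _](mulfV xp) -mulrDl invfM mulrA.
  by [].
Qed.

(* Main.v *)
Require Import Defs.
From mathcomp Require Import all_boot all_order all_algebra.
From mathcomp Require Import all_classical all_reals all_analysis.
From mathcomp Require Import ring lra.

Import Order.TTheory GRing.Theory Num.Theory.
Import numFieldNormedType.Exports.

Local Open Scope classical_set_scope.
Local Open Scope ring_scope.

(* A bounded orbit is also bounded away from 0, since x_k x_(k+1) >= 1 and
   y_k y_(k+1) >= 1.  Interleave U_k = sqrt p * ln x_k and V_k = sqrt q * ln y_k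
   as w = (U_0, V_0, U_1, V_1, ...).  As ln (1 + e^t) exceeds max (0, t) by a
   margin uniform for bounded t, and sqrt p * sqrt q >= 2, the second
   differences w_(n+1) - 2 w_n + w_(n-1) are bounded below by a positive
   constant.  Hence the first differences V_k - U_k tend to infinity, a
   contradiction. *)

Lemma ln_1DexpR_ge {R : realType} {T t : R} : `|t| <= T ->
  Num.max 0 t + ln (1 + expR (- T)) <= ln (1 + expR t).
Proof.
move=> tT; have pos (s : R) : 0 < 1 + expR s by rewrite addr_gt0// expR_gt0.
have mono (s : R) : - T <= s -> ln (1 + expR (- T)) <= ln (1 + expR s).
  by move=> Ts; rewrite ler_ln ?posrE ?pos// lerD2l ler_expR.
move: tT; rewrite ler_norml => /andP[Tt tT].
have [t0|t0] := leP t 0; first by rewrite add0r mono.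
have -> : 1 + expR t = expR t * (1 + expR (- t)).
  by rewrite mulrDr mulr1 -expRD subrr expR0 addrC.
by rewrite lnM ?posrE ?expR_gt0 ?pos// expRK lerD2l mono// lerN2.
Qed.

Lemma normr_ln_le {R : realType} {M x : R} :
  0 < x -> x <= M -> 1 <= M * x -> `|ln x| <= ln M.
Proof.
move=> x0 xM Mx; have M0 : 0 < M by exact: lt_le_trans x0 xM.
rewrite ler_norml ler_ln ?posrE// xM andbT -subr_ge0 opprK addrC.
by rewrite -lnM ?posrE// ln_ge0.
Qed.

(** Serves both [mu1] and, with [a] and [b] swapped, [mu2]. Multiplying the previous bound by [a]
    leaves [2 * (b * ln y)] to compare with [a * Num.max 0 (b ^+ 2 * ln y)]: trivial if [ln y <= 0],
    and otherwise [a * b >= 2] is applied to [b * ln y > 0]. *)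
Lemma exchange_second_difference {R : realType} {a b T x x' y : R} :
    0 < a -> 0 < b -> 2 <= a * b -> 0 < x -> 0 < x' -> 0 < y ->
    x' * x = 1 + y `^ (b ^+ 2) -> `|b ^+ 2 * ln y| <= T ->
  a * ln (1 + expR (- T)) <= a * ln x' + a * ln x - 2 * (b * ln y).
Proof.
move=> a0 b0 ab x0 x'0 y0 xx' yT.
have := ln_1DexpR_ge yT.
have <- : y `^ (b ^+ 2) = expR (b ^+ 2 * ln y) by rewrite /powR gt_eqF.
rewrite -xx' lnM ?posrE// -(ler_pM2l a0) => h.
have : 2 * (b * ln y) <= a * Num.max 0 (b ^+ 2 * ln y).
  have [t0|t0] := leP (b ^+ 2 * ln y) 0.
    rewrite mulr0 pmulr_rle0// pmulr_rle0//.
    by move: t0; rewrite pmulr_rle0// exprn_gt0.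
  have l0 : 0 < b * ln y.
    by rewrite pmulr_rgt0//; move: t0; rewrite pmulr_rgt0// exprn_gt0.
  have -> : a * (b ^+ 2 * ln y) = (a * b) * (b * ln y) by ring.
  by rewrite ler_pM2r.
lra.
Qed.

Lemma additive_growth_unbounded {R : realType} {d : nat -> R} {e : R} (B : R) :
  0 < e -> (forall k, d k + e <= d k.+1) -> ~ (forall k, d k <= B).
Proof.
move=> e0 de dB.
have dk k : d 0%N + e *+ k <= d k.
  elim: k => [|k IH]; first by rewrite mulr0n addr0.
  by rewrite mulrSr addrA (le_trans _ (de k))// lerD2r.
have := truncnS_gt ((B - d 0%N) / e); set k := (Num.trunc _).+1.
rewrite ltr_pdivrMr// mulr_natl => Bk.
have := le_trans (dk k) (dB k); lra.
Qed.

Theorem theorem2p5 (R : realType) (p q : R) (hp : 0 < p) (hq : 0 < q)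
  (hpq : 4 <= p * q) (x y : R) (hx : 0 < x) (hy : 0 < y) :
  ~ bounded_set (mu_orbit p q (x, y)).
Proof.
(* Boundedness only provides norm bounds strictly above [M0], hence [M0 + 1]. *)
move=> [M0 [_ /(_ (M0 + 1) (ltr_pwDr ltr01 (lexx _)))]]; set M := M0 + 1 => Mbd.
pose z k := iter k (mu p q) (x, y).
pose X k := (z k).1; pose Y k := (z k).2.
have z0 k : 0 < X k /\ 0 < Y k.
  elim: k => [//|k [Xk Yk]]; exact: mu_gt0.
have X0 k : 0 < X k by have [] := z0 k.
have Y0 k : 0 < Y k by have [] := z0 k.
have XS k : X k.+1 * X k = 1 + Y k `^ q.
  exact: (divfK (lt0r_neq0 (X0 k))).
have YS k : Y k.+1 * Y k = 1 + X k.+1 `^ p.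
  exact: (divfK (lt0r_neq0 (Y0 k))).
have zM k : X k <= M /\ Y k <= M.
  have /Mbd : mu_orbit p q (x, y) (z k) by exists k.
  rewrite /= prod_normE ge_max => /andP[Xk Yk].
  by split; [exact: le_trans (ler_norm _) Xk|exact: le_trans (ler_norm _) Yk].
have XM k : X k <= M by have [] := zM k.
have YM k : Y k <= M by have [] := zM k.
have lnX k : `|ln (X k)| <= ln M.
  apply: normr_ln_le => //; apply: (@le_trans _ _ (X k.+1 * X k)).
    by rewrite XS lerDl powR_ge0.
  by rewrite ler_pM2r.
have lnY k : `|ln (Y k)| <= ln M.
  apply: normr_ln_le => //; apply: (@le_trans _ _ (Y k.+1 * Y k)).
    by rewrite YS lerDl powR_ge0.
  by rewrite ler_pM2r.
pose a := Num.sqrt p; pose b := Num.sqrt q.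
have a0 : 0 < a by rewrite sqrtr_gt0.
have b0 : 0 < b by rewrite sqrtr_gt0.
have pE : p = a ^+ 2 by rewrite sqr_sqrtr// ltW.
have qE : q = b ^+ 2 by rewrite sqr_sqrtr// ltW.
have ab : 2 <= a * b.
  rewrite -ler_sqr ?nnegrE ?mulr_ge0 ?(ltW a0) ?(ltW b0)// exprMn -pE -qE.
  by apply: le_trans hpq; lra.
clearbody a b; subst p q.
(* One [T] for both exponents, so that both half-steps have the same margin. *)
pose T := (a ^+ 2 + b ^+ 2) * ln M.
have lnT (c l : R) : c ^+ 2 <= a ^+ 2 + b ^+ 2 -> `|l| <= ln M ->
    `|c ^+ 2 * l| <= T.
  by move=> cab lM; rewrite normrM ger0_norm ?sqr_ge0// ler_pM ?sqr_ge0.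
have e0 : 0 < ln (1 + expR (- T)) by rewrite ln_gt0// ltrDl expR_gt0.
pose d k := b * ln (Y k) - a * ln (X k).
apply: (@additive_growth_unbounded _ d ((a + b) * ln (1 + expR (- T)))
  ((a + b) * ln M)) => [|k|k].
- by rewrite mulr_gt0// addr_gt0.
(* [d k.+1 - d k] is the sum of two consecutive second differences, centred at [b * ln (Y k)] and
   [a * ln (X k.+1)]; their margins carry the factors [a] and [b]. *)
- have := exchange_second_difference a0 b0 ab (X0 k) (X0 k.+1) (Y0 k) (XS k)
    (lnT _ _ _ (lnY k)).
  rewrite lerDr sqr_ge0 => /(_ isT).
  rewrite mulrC in ab.
  have := exchange_second_difference b0 a0 ab (Y0 k) (Y0 k.+1) (X0 k.+1) (YS k)
    (lnT _ _ _ (lnX k.+1)).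
  rewrite lerDl sqr_ge0 /d => /(_ isT); lra.
- have := lnX k; have := lnY k.
  rewrite !ler_norml => /andP[_ Yk] /andP[Xk _].
  rewrite /d mulrDl addrC lerD// ?ler_pM2l// -mulrN ler_pM2l//; lra.
Qed.
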